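(* Let $X$ be a $\mathcal{B}$ real Banach space, $C$ a nonempty closed convex subset of $X$, $T_n : C \to C$ ($n\in\mathbb{N}$) a sequence of nonexpansive mappings, $T : C\to C$ a nonexpansive mapping, and $f : C\to C$ an $\alpha$-contraction for some $\alpha\in(0,1)$. Assume that $\mathrm{Fix}(T)\neq\emptyset$ and that $\mathrm{Fix}(T)\subset \mathrm{Fix}(T_n)$ for all $n\in\mathbb{N}$. Let $\{\alpha_n\}$ be a sequence of real numbers for which there is a fixed integer $N\ge 1$ such that: (i) $\alpha_n\in(0,1)$ for all $n$; (ii) $\lim_{n\to\infty}\alpha_n=0$; (iii) $\sum_{n=0}^\infty \alpha_n=\infty$; and either (iv) $\sum_{n=0}^\infty|\alpha_{n+N}-\alpha_n|<\infty$ or (iv') $\lim_{n\to\infty}\alpha_{n+N}/\alpha_n=1$. Let $x_0\in C$ and let $\{x_n\}$ be defined by $$x_{n+1}=\alpha_n f(x_n)+(1-\alpha_n)T_nx_n .$$ Suppose that there exists $p\in \mathrm{Fix}(T)$ such that $$\limsup_{n\to\infty}\langle f(p)-p, J(x_n-p)\rangle\le 0 .$$ Then $\{x_n\}$ converges strongly to $p$.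
   Context: A mapping $T:C\to C$ is nonexpansive if $\|Tx-Ty\|\le\|x-y\|$ for all $x,y\in C$; $f:C\to C$ is an $\alpha$-contraction ($\alpha\in(0,1)$) if $\|f(x)-f(y)\|\le\alpha\|x-y\|$ for all $x,y\in C$. $\mathrm{Fix}(T)=\{x\in C: Tx=x\}$. The normalized duality map is $J(x)=\{x^\star\in X^\star:\langle x,x^\star\rangle=\|x\|^2=\|x^\star\|^2\}$. A ''$\mathcal{B}$ real Banach space'' is a real Banach space $X$ such that either (a) the normalized duality mapping $J$ is (single-valued and) uniformly norm-to-weak$^\star$ continuous on bounded sets, or (b) $X$ is reflexive and admits a weakly continuous duality mapping $J_\phi$ with gauge $\phi$, i.e. $\phi:[0,\infty)\to[0,\infty)$ is continuous, strictly increasing, $\phi(0)=0$, $\phi(t)\to\infty$ as $t\to\infty$, and $J_\phi(x)=\{x^\star\in X^\star:\langle x,x^\star\rangle=\|x\|\phi(\|x\|),\ \|x^\star\|=\phi(\|x\|)\}$ is single-valued and weak-to-weak$^\star$ sequentially continuous. In both cases $J$ is single-valued and is regarded as a map $X\to X^\star$. *)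

(* Defs.v *)
From HB Require Import structures.
From mathcomp Require Import all_boot all_order all_algebra.
From mathcomp Require Import all_classical all_reals all_analysis.

Set Implicit Arguments.
Unset Strict Implicit.
Unset Printing Implicit Defensive.

Import Order.TTheory GRing.Theory Num.Theory.
Import numFieldNormedType.Exports.

Local Open Scope classical_set_scope.
Local Open Scope ring_scope.

Section dual_space.
Context {R : realType} (X : normedModType R).

(* [X -> R] is an R-module, with R acting on itself by multiplication. *)
Definition is_functional : {pred X -> R} :=
  mem [set j : X -> R | linear j /\ continuous j].

Record dual := Dual {
  dual_fun :> X -> R ;
  _ : dual_fun \in is_functional }.

HB.instance Definition _ := [isSub for dual_fun].
HB.instance Definition _ := [Choice of dual by <:].

Lemma dual_linear (j : dual) : linear j.
Proof. by case: j => j /= /[!inE] -[]. Qed.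

Lemma dual_continuous (j : dual) : continuous j.
Proof. by case: j => j /= /[!inE] -[]. Qed.

HB.instance Definition _ (j : dual) :=
  GRing.isLinear.Build R X R *:%R j (@dual_linear j).

Lemma is_functional_submod_closed : submod_closed is_functional.
Proof.
split.
  rewrite inE/=; split; last by move=> x; exact: cvg_cst.
  by move=> a u v /=; rewrite scaler0 addr0.
move=> a u v /[!inE]/= -[lu cu] [lv cv]; split.
  move=> b x y; rewrite !fctE/= lu lv !scalerDr !scalerA (mulrC b).
  by rewrite addrACA.
by move=> x; apply: cvgD; [apply: cvgZr; exact: cu|exact: cv].
Qed.

HB.instance Definition _ := GRing.isSubmodClosed.Build R (X -> R) is_functional
  is_functional_submod_closed.
HB.instance Definition _ := [SubChoice_isSubLmodule of dual by <:].

Definition dual_norm (j : dual) : R :=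
  sup [set `|j x| | x in [set x : X | `|x| <= 1]].

Let S (j : dual) := [set `|j x| | x in [set x : X | `|x| <= 1]].

Let S_sup j : has_sup (S j).
Proof.
split; first by exists `|j 0|, 0 => //=; rewrite normr0.
have /bounded_funP/(_ 1)[M jM] := (linear_bounded_continuous j).2 (@dual_continuous j).
by exists M => _ [x /= x1 <-]; exact: jM.
Qed.

Lemma dual_norm_ge0 j : 0 <= dual_norm j.
Proof.
apply: le_trans (normr_ge0 (j 0)) _; apply: ub_le_sup; first by case: (S_sup j).
by exists 0 => //=; rewrite normr0.
Qed.

Lemma dual_norm_bound (j : dual) x : `|j x| <= dual_norm j * `|x|.
Proof.
have [->|x0] := eqVneq x 0; first by rewrite linear0 !normr0 mulr0.
rewrite -ler_pdivrMr ?normr_gt0//.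
apply: ub_le_sup; first by case: (S_sup j).
exists (`|x|^-1 *: x) => /=.
  by rewrite normrZ normfV normr_id mulVf// normr_eq0.
by rewrite linearZ/= normrM normfV normr_id mulrC.
Qed.

Lemma dual_norm_le (j : dual) M :
  (forall x, `|x| <= 1 -> `|j x| <= M) -> dual_norm j <= M.
Proof. by move=> jM; apply: sup_le_ub; [case: (S_sup j)|move=> _ [x /= ? <-]; exact: jM]. Qed.

Let dual_normD (j k : dual) : dual_norm (j + k) <= dual_norm j + dual_norm k.
Proof.
apply: dual_norm_le => x x1; apply: (le_trans (ler_normD _ _)).
by apply: lerD; (apply: le_trans (dual_norm_bound _ _) _);
  rewrite ler_piMr ?dual_norm_ge0.
Qed.

Let dual_normZ_le a (j : dual) : dual_norm (a *: j) <= `|a| * dual_norm j.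
Proof.
apply: dual_norm_le => x x1.
have -> : (a *: j) x = a * j x by [].
rewrite normrM ler_wpM2l//.
by apply: le_trans (dual_norm_bound _ _) _; rewrite ler_piMr ?dual_norm_ge0.
Qed.

Let dual_normZ a (j : dual) : dual_norm (a *: j) = `|a| * dual_norm j.
Proof.
apply/eqP; rewrite eq_le dual_normZ_le /=.
have [->|a0] := eqVneq a 0; first by rewrite normr0 mul0r dual_norm_ge0.
have /= := dual_normZ_le a^-1 (a *: j).
rewrite scalerA mulVf// scale1r normfV.
by rewrite -ler_pdivlMl ?invr_gt0 ?normr_gt0// invrK.
Qed.

Let dual_norm0_eq0 (j : dual) : dual_norm j = 0 -> j = 0.
Proof.
move=> j0; apply/val_inj/funext => x /=.
apply/eqP; rewrite -normr_le0.
by rewrite (le_trans (dual_norm_bound _ _))// j0 mul0r.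
Qed.

HB.instance Definition _ := Lmodule_isNormed.Build R dual
  dual_normD dual_normZ dual_norm0_eq0.

Lemma dual_normE (j : dual) : `|j| = dual_norm j.
Proof. by []. Qed.

End dual_space.

Section duality_mappings.
Context {R : realType} (X : normedModType R).
Implicit Types (D : X -> set (dual X)) (J : X -> dual X).

Definition reflexive_space :=
  forall F : dual (dual X), exists x : X, forall j : dual X, F j = j x.

Definition weakly_cvg (u : nat -> X) (x : X) :=
  forall j : dual X, j (u n) @[n --> \oo] --> j x.

Definition weakly_star_cvg (u : nat -> dual X) (j : dual X) :=
  forall v : X, u n v @[n --> \oo] --> j v.

Definition single_valued D := forall x, exists! j, D x j.

(* For a single-valued [D], the map [x |-> the unique element of D x];
   [0] is a dummy value. *)
Definition selection D : X -> dual X := fun x => xget 0 (D x).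

(* The weak-star uniformity is generated by the seminorms [j |-> `|j v|]. *)
Definition unif_norm_weak_star_continuous_on_bounded J :=
  forall B : set X, bounded_set B -> forall (v : X) (e : R), 0 < e ->
  exists2 d : R, 0 < d &
    forall x y, B x -> B y -> `|x - y| < d -> `|J x v - J y v| < e.

Definition weak_weak_star_seq_continuous J :=
  forall (u : nat -> X) (x : X), weakly_cvg u x -> weakly_star_cvg (J \o u) (J x).

Definition normalized_duality (x : X) : set (dual X) :=
  [set j : dual X | j x = `|x| ^+ 2 /\ `|x| ^+ 2 = `|j| ^+ 2].

(* Only the values of [phi] on [0, +oo[ matter; its nonnegativity there
   follows from monotonicity and [phi 0 = 0]. *)
Definition gauge (phi : R -> R) :=
  [/\ {within `[0, +oo[, continuous phi},
      {in `[0, +oo[ &, {homo phi : s t / s < t}},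
      phi 0 = 0 &
      phi t @[t --> +oo] --> +oo].

Definition gauge_duality (phi : R -> R) (x : X) : set (dual X) :=
  [set j : dual X | j x = `|x| * phi `|x| /\ `|j| = phi `|x|].

Definition duality_map : X -> dual X := selection normalized_duality.

Definition B_space :=
  (single_valued normalized_duality /\
   unif_norm_weak_star_continuous_on_bounded duality_map) \/
  (reflexive_space /\ exists phi : R -> R,
    [/\ gauge phi, single_valued (gauge_duality phi) &
        weak_weak_star_seq_continuous (selection (gauge_duality phi))]).

Lemma selectionE D : single_valued D -> forall x, D x = [set selection D x].
Proof.
move=> sD x; have [j [Dj ju]] := sD x.
by rewrite /selection; case: xgetP => [k -> Dk|/(_ j)//];
  apply/seteqP; split => [l Dl|_ ->//]; rewrite /= -(ju _ Dk) -(ju _ Dl).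
Qed.

Lemma gauge_duality_single_valued phi : gauge phi ->
  single_valued (gauge_duality phi) -> single_valued normalized_duality.
Proof.
move=> [_ phi_incr phi0 _] sv x.
have [->|x0] := eqVneq x 0.
  exists 0; split; first by split; rewrite ?linear0 !normr0 ?expr0n.
  move=> j [_ /esym/eqP]; rewrite normr0 expr0n/= sqrf_eq0 normr_eq0.
  by move/eqP.
have nx : 0 < `|x| by rewrite normr_gt0.
have px : 0 < phi `|x|.
  by rewrite -[ltLHS]phi0; apply: phi_incr; rewrite ?in_itv/= ?lexx ?normr_ge0.
have [j [[jx nj] ju]] := sv x.
exists ((`|x| / phi `|x|) *: j); split.
  split.
    have -> : ((`|x| / phi `|x|) *: j) x = `|x| / phi `|x| * j x by [].
    by rewrite jx mulrCA divfK ?gt_eqF// expr2.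
  by rewrite normrZ nj gtr0_norm ?divr_gt0// divfK ?gt_eqF.
move=> k [kx /esym nk].
have {}nk : `|k| = `|x|.
  by apply/eqP; rewrite -(@eqrXn2 _ 2)// nk.
rewrite (ju ((phi `|x| / `|x|) *: k)).
  by rewrite scalerA mulrA divfK ?gt_eqF// mulfV ?gt_eqF// scale1r.
split.
  have -> : ((phi `|x| / `|x|) *: k) x = phi `|x| / `|x| * k x by [].
  by rewrite kx expr2 mulrA divfK ?gt_eqF// mulrC.
by rewrite normrZ nk gtr0_norm ?divr_gt0// divfK ?gt_eqF.
Qed.

Lemma duality_mapE : B_space ->
  forall x, normalized_duality x = [set duality_map x].
Proof.
case=> [[sv _]|[_ [phi [gphi sv _]]]]; apply: selectionE => //.
exact: gauge_duality_single_valued sv.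
Qed.

End duality_mappings.

Definition Fix {R : realType} {X : normedModType R} (C : set X) (T : X -> X) :
  set X := [set x | C x /\ T x = x].

(* Main.v *)
(* Pairing x_{n+1} - p with its dual element J(x_{n+1} - p) gives, for
   u_n = |x_n - p|^2 and g_n = (1 - a) alpha_n,
     (1 + g_n) u_{n+1} <= (1 - g_n) u_n + 2 alpha_n <f p - p, J (x_{n+1} - p)>.
   The last pairing is eventually at most (1 - a) d for any d > 0, so that
   (1 + g_n) (u_{n+1} - d) <= (1 - g_n) (u_n - d), and the divergence of the
   series of the g_n brings u_n eventually below 2 d. *)
Require Import Defs.
From HB Require Import structures.
From mathcomp Require Import all_boot all_order all_algebra.
From mathcomp Require Import all_classical all_reals all_analysis.
From mathcomp Require Import ring lra.

Set Implicit Arguments.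
Unset Strict Implicit.
Unset Printing Implicit Defensive.

Import Order.TTheory GRing.Theory Num.Theory.
Import numFieldNormedType.Exports.

Local Open Scope classical_set_scope.
Local Open Scope ring_scope.

(** Where [w n.+1] is nonpositive the bound is trivial. Otherwise the step forces [w n] to be
    nonnegative, hence (1 + g_n) w_{n+1} <= w_n, and since (1 + g_n)(1 + S) >= 1 + S + g_n for the
    partial sum S, the left-hand side does not increase. *)
Lemma decay_bound (R : realType) (g w : nat -> R) (m n : nat) :
    (forall k, 0 <= g k <= 1) ->
    (forall k, (m <= k)%N -> (1 + g k) * w k.+1 <= (1 - g k) * w k) ->
    (m <= n)%N ->
  w n * (1 + \sum_(m <= k < n) g k) <= `|w m|.
Proof.
move=> g01 step; elim: n => [|n IHn].
  by rewrite leqn0 => /eqP ->; rewrite big_geq// addr0 mulr1 ler_norm.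
rewrite leq_eqVlt => /predU1P[<-|]; first by rewrite big_geq// addr0 mulr1 ler_norm.
rewrite ltnS => mn; rewrite big_nat_recr//=.
have S0 : 0 <= \sum_(m <= k < n) g k.
  by apply: sumr_ge0 => k _; case/andP: (g01 k).
have /andP[gn0 gn1] := g01 n.
have [wn0|wn0] := leP (w n.+1) 0.
  by apply: le_trans (normr_ge0 _); rewrite mulr_le0_ge0//; lra.
have wn : (1 + g n) * w n.+1 <= w n .
  have wn' : 0 <= w n by rewrite leNgt; apply/negP => ?; have := step n mn; nra.
  by have := step n mn; nra.
apply: le_trans (IHn mn); set S := \sum_(m <= k < n) g k in S0 *.
have : (1 + g n) * w n.+1 * (1 + S) <= w n * (1 + S) by rewrite ler_wpM2r// addr_ge0.
have : 0 <= g n * S * w n.+1 by rewrite !mulr_ge0// ltW.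
lra.
Qed.

Lemma nneseries_pinfty_tail (R : realType) (u : nat -> R) (m : nat) (A : R) :
    (\sum_(0 <= n <oo) (u n)%:E = +oo)%E -> (forall n, 0 <= u n) ->
  \forall n \near \oo, A <= \sum_(m <= k < n) u k.
Proof.
move=> uoo u0.
have : (\sum_(0 <= k < n) (u k)%:E)%E @[n --> \oo] --> +oo%E.
  by rewrite -uoo; apply: is_cvg_nneseries => n _ _; rewrite lee_fin.
move/cvgeyPge => /(_ (A + \sum_(0 <= k < m) u k)).
apply: filterS2 (nbhs_infty_ge m) => n mn.
rewrite sumEFin lee_fin (big_cat_nat _ mn)//=.
by rewrite [leRHS]addrC lerD2r.
Qed.

Lemma quasi_contraction_cvg0 (R : realType) (g u : nat -> R) :
    (forall n, 0 <= g n <= 1) -> (\sum_(0 <= n <oo) (g n)%:E = +oo)%E ->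
    (forall n, 0 <= u n) ->
    (forall d, 0 < d -> \forall n \near \oo,
      (1 + g n) * u n.+1 <= (1 - g n) * u n + 2 * g n * d) ->
  u n @[n --> \oo] --> 0.
Proof.
move=> g01 goo u0 ustep; apply/cvgr0Pnorm_le => e e0.
have e2 : 0 < e / 2 by rewrite divr_gt0.
have [m _ mstep] := ustep _ e2.
have bound n := @decay_bound R g (fun k => u k - e / 2) m n g01.
have g0 n : 0 <= g n by case/andP: (g01 n).
(* Once the partial sum S exceeds this threshold, [decay_bound] gives (u_n - e/2)(1 + S) <= S e/2,
   which is impossible if u_n > e. *)
have := nneseries_pinfty_tail m (`|u m - e / 2| / (e / 2)) goo g0.
apply: filterS2 (nbhs_infty_ge m) => n mn.
rewrite ler_pdivrMr// => nA; rewrite ger0_norm//.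
have {bound} : (u n - e / 2) * (1 + \sum_(m <= k < n) g k) <= `|u m - e / 2|.
  by apply: bound => // k /mstep /=; nra.
have S0 : 0 <= \sum_(m <= k < n) g k by apply: sumr_ge0 => k _.
move=> /le_trans /(_ nA) H; rewrite leNgt; apply/negP => une.
by move: H; apply/negP; rewrite -ltNge; nra.
Qed.

(** The upper limit is an infimum, over neighbourhoods of infinity, of suprema, so some
    neighbourhood already has its supremum below [e]. *)
Lemma limn_esup_le_near_lt (R : realType) (u : nat -> R) (l e : R) :
  (limn_esup (EFin \o u) <= l%:E)%E -> l < e -> \forall n \near \oo, u n < e.
Proof.
move=> ul le; have : (limn_esup (EFin \o u) < e%:E)%E.
  by apply: le_lt_trans ul _; rewrite lte_fin.
rewrite /limn_esup limf_esupE => /ereal_inf_lt[_ [V Voo <-]] supV.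
apply: filterS Voo => n Vn; rewrite -lte_fin.
by apply: le_lt_trans supV; apply: ereal_sup_ubound; exists n.
Qed.

Lemma convex_set_comb (R : realType) (X : lmodType R) (C : set X) (t : R) (y z : X) :
    convex_set (C : set (convex_lmodType X)) -> 0 <= t <= 1 -> C y -> C z ->
  C (t *: y + (1 - t) *: z).
Proof.
move=> cC /andP[t0 t1] Cy Cz.
(* [convex_set] takes its coefficient bundled with a proof that it lies in the unit interval. *)
have t01 : Itv.spec (@Itv.num_sem R) (Itv.Real `[0%Z, 1%Z]) t.
  by apply/and3P; split; rewrite ?bnd_simp//= ger0_real.
by have := cC y z (Itv.mk t01) (mem_set Cy) (mem_set Cz) => /set_mem.
Qed.

Lemma duality_map_self (R : realType) (X : completeNormedModType R) (z : X) :
  B_space X -> duality_map z z = `|z| ^+ 2.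
Proof.
move=> hX; have [] // : normalized_duality z (duality_map z).
by rewrite duality_mapE.
Qed.

Lemma duality_map_le (R : realType) (X : completeNormedModType R) (z y : X) :
  B_space X -> duality_map z y <= `|z| * `|y|.
Proof.
move=> hX; have [_ /eqP] : normalized_duality z (duality_map z).
  by rewrite duality_mapE.
rewrite eqrXn2// => /eqP ->; apply: le_trans (ler_norm _) _.
exact: dual_norm_bound.
Qed.

Lemma viscosity_step (R : realType) (X : completeNormedModType R)
    (t a : R) (x x' p q fx Tx : X) :
    B_space X -> 0 <= t <= 1 -> 0 <= a <= 1 ->
    `|fx - q| <= a * `|x - p| -> `|Tx - p| <= `|x - p| ->
    x' = t *: fx + (1 - t) *: Tx ->
  (1 + (1 - a) * t) * `|x' - p| ^+ 2 <=
    (1 - (1 - a) * t) * `|x - p| ^+ 2 + 2 * t * duality_map (x' - p) (q - p).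
Proof.
move=> hX /andP[t0 t1] /andP[a0 a1] fxq Txp x'E; set j := duality_map (x' - p).
set U := `|x' - p|; set V := `|x - p|.
(* Apply j to x' - p = t (fx - q) + (1 - t) (Tx - p) + t (q - p). The first two terms are controlled
   by the contraction and nonexpansiveness bounds; the third is kept. *)
have UE : U ^+ 2 = t * j (fx - q) + (1 - t) * j (Tx - p) + t * j (q - p).
  rewrite -duality_map_self// -/j {1}x'E !linearB linearD !linearZ/=.
  by rewrite /GRing.scale/=; ring.
have jf : t * j (fx - q) <= t * (U * (a * V)).
  by rewrite ler_wpM2l// (le_trans (duality_map_le _ _ hX))// ler_wpM2l.
have jT : (1 - t) * j (Tx - p) <= (1 - t) * (U * V).
  rewrite ler_wpM2l ?subr_ge0//.
  by rewrite (le_trans (duality_map_le _ _ hX))// ler_wpM2l.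
(* The bounds [jf] and [jT] add up to c U V with c = t a + (1 - t) = 1 - (1 - a) t. After doubling,
   2 U V <= U^2 + V^2 applies, and moving c U^2 to the left leaves the coefficient 2 - c = 1 + (1 -
   a) t. *)
have UV : (1 - (1 - a) * t) * (2 * U * V) <= (1 - (1 - a) * t) * (U ^+ 2 + V ^+ 2).
  have UV2 : 0 <= (U - V) ^+ 2 by exact: sqr_ge0.
  apply: ler_wpM2l; [nra|lra].
lra.
Qed.

Theorem theorem3 (R : realType) (X : completeNormedModType R)
    (hX : B_space X)
    (C : set X) (C_nonempty : C !=set0) (C_closed : closed C)
    (C_convex : convex_set (C : set (convex_lmodType X)))
    (Tn : nat -> X -> X) (T f : X -> X)
    (Tn_maps : forall n, set_fun C C (Tn n))
    (Tn_nonexp : forall n, 1.-lipschitz_C (Tn n))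
    (T_maps : set_fun C C T)
    (T_nonexp : 1.-lipschitz_C T)
    (a : R) (a_gt0 : 0 < a) (a_lt1 : a < 1)
    (f_maps : set_fun C C f)
    (f_contr : a.-lipschitz_C f)
    (FixT : Fix C T !=set0)
    (FixT_sub : forall n, Fix C T `<=` Fix C (Tn n))
    (alpha : nat -> R) (N : nat) (N_ge1 : (1 <= N)%N)
    (alpha01 : forall n, 0 < alpha n < 1)
    (alpha_cvg0 : alpha n @[n --> \oo] --> 0)
    (alpha_div : (\sum_(0 <= n <oo) (alpha n)%:E = +oo)%E)
    (alpha_var :
      (\sum_(0 <= n <oo) `|alpha (n + N)%N - alpha n|%:E < +oo)%E \/
      alpha (n + N)%N / alpha n @[n --> \oo] --> (1 : R))
    (x : nat -> X) (x0C : C (x 0%N))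
    (x_rec : forall n,
      x n.+1 = alpha n *: f (x n) + (1 - alpha n) *: Tn n (x n))
    (p : X) (p_fix : Fix C T p)
    (p_limsup :
      (limn_esup (fun n => (duality_map (x n - p) (f p - p))%:E) <= 0)%E) :
  x n @[n --> \oo] --> p.
Proof.
have [Cp _] := p_fix.
have xC n : C (x n).
  elim: n => [//|n xnC]; rewrite x_rec; apply: convex_set_comb => //.
  - by have /andP[/ltW -> /ltW ->] := alpha01 n.
  - exact: f_maps.
  - exact: Tn_maps.
have f_le n : `|f (x n) - f p| <= a * `|x n - p|.
  exact: (f_contr (x n, p) (conj (xC n) Cp)).
have T_le n : `|Tn n (x n) - p| <= `|x n - p|.
  have [_ Tp] := FixT_sub n _ p_fix; rewrite -{1}Tp.
  by rewrite -[leRHS]mul1r; exact: (Tn_nonexp n (x n, p) (conj (xC n) Cp)).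
have a1 : 0 < 1 - a by rewrite subr_gt0.
suff : `|x n - p| ^+ 2 @[n --> \oo] --> 0.
  move=> u0; apply/cvgrPdist_lt => e e0.
  have /cvgr0Pnorm_lt/(_ _ (exprn_gt0 2 e0)) := u0.
  apply: filterS => n; rewrite normrX normr_id distrC.
  by rewrite ltr_pXn2r ?nnegrE// ltW.
apply: (@quasi_contraction_cvg0 _ (fun n => (1 - a) * alpha n)).
- by move=> n; have /andP[] := alpha01 n; nra.
- under eq_eseriesr do rewrite EFinM.
  rewrite nneseriesZl; last by move=> n _; have /andP[/ltW] := alpha01 n.
  by rewrite alpha_div gt0_muley// lte_fin.
- by move=> n; exact: sqr_ge0.
move=> d d0.
(* The factor 1 - a in the threshold turns the pairing term into 2 g_n d. The pairing in the step
   involves x_{n+1}, so the bound is used at index [n.+1]. *)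
have [m _ mP] := limn_esup_le_near_lt p_limsup (mulr_gt0 a1 d0).
exists m => // n /= /leqW/(mP n.+1)/= jn.
have /andP[an0 an1] := alpha01 n.
have an : 0 <= alpha n <= 1 by rewrite !ltW.
have a01 : 0 <= a <= 1 by rewrite !ltW.
have := viscosity_step hX an a01 (f_le n) (T_le n) (x_rec n).
nra.
Qed.
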